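(* For every real $\alpha\in(0,\tfrac12)$ there is $\nu_0=\nu_0(\alpha)>0$ such that for every $0<\nu<\nu_0$, the random graph $G_{\mathrm{Po}}(n;\alpha,\nu)$ has no near perfect matching with probability $1-o(n^{-1/2})$ as $n\to\infty$.
   Context: KPKVB model: fix $\alpha>0$, $\nu>0$, an integer $n>\nu$, and $R=2\ln(n/\nu)$. $\mathcal D_R$ is the hyperbolic disk (curvature $-1$) of radius $R$ around the origin, with polar coordinates $(r,\theta)$, $r\in[0,R)$, $\theta\in(0,2\pi]$; $f_{\alpha,R}(r,\theta)=\frac{\alpha\sinh(\alpha r)}{2\pi(\cosh(\alpha R)-1)}$. Poissonised model $G_{\mathrm{Po}}(n;\alpha,\nu)$: the vertex set is a Poisson point process $\mathcal P$ on $\mathcal D_R$ with intensity measure $n f_{\alpha,R}(r,\theta)\,dr\,d\theta$, two distinct points adjacent iff their hyperbolic distance is at most $R$. A near perfect matching is a matching covering all but at most one vertex. *)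

(* Defs.v *)
From HB Require Import structures.
From mathcomp Require Import all_boot all_order all_algebra.
From mathcomp Require Import all_classical all_reals all_analysis.
Set Implicit Arguments. Unset Strict Implicit. Unset Printing Implicit Defensive.
Import Order.TTheory GRing.Theory Num.Theory.
Import numFieldNormedType.Exports.
Local Open Scope classical_set_scope.
Local Open Scope ring_scope.

Section KPKVB.
Variable R : realType.

Definition sinh (x : R) : R := (expR x - expR (- x)) / 2.
Definition cosh (x : R) : R := (expR x + expR (- x)) / 2.

(* A point of the hyperbolic plane in polar coordinates (r, theta). *)
Definition point := (R * R)%type.

Definition diskR (n : nat) (nu : R) : R := 2 * ln (n%:R / nu).

Definition in_disk (Rad : R) (p : point) : bool :=
  (0 <= p.1) && (p.1 < Rad) && (0 < p.2) && (p.2 <= 2 * pi).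

Definition dens (alpha Rad : R) (p : point) : R :=
  if in_disk Rad p then
    alpha * sinh (alpha * p.1) / (2 * pi * (cosh (alpha * Rad) - 1))
  else 0.

(* cosh of the hyperbolic distance (curvature -1) between two points given in
   polar coordinates (hyperbolic law of cosines). *)
Definition cosh_hdist (p q : point) : R :=
  cosh p.1 * cosh q.1 - sinh p.1 * sinh q.1 * cos (p.2 - q.2).

(* Two points are within hyperbolic distance Rad (Rad >= 0) iff
   cosh(dist) <= cosh Rad, cosh being increasing on [0, +oo). *)
Definition hclose (Rad : R) (p q : point) : bool := cosh_hdist p q <= cosh Rad.

Definition adj (Rad : R) (s : seq point) (i j : 'I_(size s)) : bool :=
  (i != j) && hclose Rad (nth (0, 0) s i) (nth (0, 0) s j).

Definition is_matching k (E : 'I_k -> 'I_k -> bool) (M : {set {set 'I_k}}) :=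
  (forall e, e \in M -> exists i j, [/\ i != j, E i j & e = [set i; j]%SET]) /\
  finset.trivIset M.

Definition has_near_perfect_matching k (E : 'I_k -> 'I_k -> bool) : Prop :=
  exists M : {set {set 'I_k}}, is_matching E M /\ (k <= #|finset.cover M|.+1)%N.

Definition no_npm (Rad : R) (s : seq point) : Prop :=
  ~ has_near_perfect_matching (@adj Rad s).

(* k-fold integral of g over k i.i.d. points with density dens alpha Rad
   w.r.t. Lebesgue measure dr dtheta (iterated, Tonelli). *)
Fixpoint iid_int (alpha Rad : R) (k : nat) (g : seq point -> \bar R) : \bar R :=
  match k with
  | 0 => g [::]
  | k'.+1 =>
    (\int[lebesgue_measure]_r \int[lebesgue_measure]_th
       ((dens alpha Rad (r, th))%:E *
          iid_int alpha Rad k' (fun s => g ((r, th) :: s))))%E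
  end.

Definition iid_prob (alpha Rad : R) (k : nat) (P : seq point -> Prop) : \bar R :=
  iid_int alpha Rad k (fun s => (\1_P s)%:E).

(* Probability that the Poisson point process with intensity n f_{alpha,R}
   dr dtheta on D_R satisfies P.  Since f integrates to 1 on D_R, the number
   of points is Poisson(n) and given k points they are i.i.d. with density f. *)
Definition poisson_prob (n : nat) (alpha Rad : R) (P : seq point -> Prop)
  : \bar R :=
  (\sum_(k <oo) ((expR (- n%:R) * n%:R ^+ k / k`!%:R)%:E
                   * iid_prob alpha Rad k P))%E.

Definition GPo_prob (n : nat) (alpha nu : R) (Q : R -> seq point -> Prop)
  : \bar R :=
  let Rad := diskR n nu in poisson_prob n alpha Rad (Q Rad).

End KPKVB.

(* Main.v *)
Require Import Defs.
From HB Require Import structures.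
From mathcomp Require Import all_boot all_order all_algebra.
From mathcomp Require Import all_classical all_reals all_analysis.
From mathcomp Require Import measurable_realfun.
From mathcomp Require Import lra ring zify.
Import Order.TTheory GRing.Theory Num.Theory.
Import numFieldNormedType.Exports.
Local Open Scope ring_scope.

(** Reveal the points one at a time and call a point good if it lies in the
    boundary layer r >= Rad - C and its angle is at distance more than d from the
    angles of all earlier points, d being the angular range of adjacency inside
    the layer. Good points form an independent set, so every matching edge uses
    a bad point, and a near perfect matching forces 2 * #bad + 1 >= #points.
    Given the past, a point is good with probability at least 5/6 once C is
    large and nu is small, as long as there are at most 3n points. An exponential
    moment bound on the number of bad points, followed by the Poisson mixture
    over the number of points, gives failure probability at most 3 e^(-n/4). *)

(** An edge inside [G] is impossible, so each edge of [M] pays for its two ends with a vertex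
    outside [G]. Edges are disjoint, so no such vertex pays twice. *)
Lemma card_cover_matching k (E : 'I_k -> 'I_k -> bool) (M : {set {set 'I_k}})
    (G : {set 'I_k}) :
  is_matching E M -> {in G &, forall i j, E i j = false} ->
  (#|finset.cover M| <= 2 * \sum_(i < k) (i \notin G))%N.
Proof.
move=> [ME Mtriv] Gindep; rewrite -sum1_card (finset.big_trivIset _ Mtriv) /=.
have le2 : (\sum_(e in M) \sum_(i in e) 1 <=
            \sum_(e in M) 2 * \sum_(i in e) (i \notin G))%N.
  apply: leq_sum => e /ME [i [j [ij Eij ->]]].
  rewrite !big_setU1 ?inE//= !big_set1.
  case: (boolP (i \in G)) => Gi; case: (boolP (j \in G)) => Gj //.
  by rewrite (Gindep i j) in Eij.
apply: (leq_trans le2); rewrite -big_distrr/= leq_mul2l/= -finset.big_trivIset//=.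
by rewrite big_mkcond/=; apply: leq_sum => i _; case: ifP.
Qed.

(** * Good points and matchings *)

Section Goodness.
Context {R : realType}.
Implicit Types (Rad C d t : R) (cs : seq R) (x y : Defs.point R)
  (s : seq (Defs.point R)).

(* For two angles in (0, 2 pi], being close modulo 2 pi means being close to one
   of these three lifts. *)
Definition angle_lifts t : seq R := [:: t - 2 * pi; t; t + 2 * pi].

Definition good Rad C d cs x : bool :=
  [&& in_disk Rad x, Rad - C <= x.1 & all (fun c => d < `|x.2 - c|) cs].

(* [cs] collects the lifts of the angles of the points already revealed. *)
Fixpoint nbad Rad C d cs s : nat :=
  if s is x :: s' then
    (~~ good Rad C d cs x + nbad Rad C d (angle_lifts x.2 ++ cs) s')%N
  else 0%N.

(** The accumulator that [nbad] carries after reading [s]. It lets the goodness of the j-th point be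
    stated without recursion. *)
Definition all_lifts cs s : seq R :=
  foldl (fun cs x => angle_lifts x.2 ++ cs) cs s.

Lemma nbadE Rad C d cs s : nbad Rad C d cs s =
  (\sum_(j < size s) ~~ good Rad C d (all_lifts cs (take j s))
                           (nth (0%R, 0%R) s j))%N.
Proof.
elim: s cs => [|x s ih] cs; first by rewrite big_ord0.
by rewrite big_ord_recl/= ih.
Qed.

Lemma sub_all_lifts cs s : {subset cs <= all_lifts cs s}.
Proof.
elim: s cs => [|x s ih] cs c ccs //=.
by apply: ih; rewrite !inE ccs !orbT.
Qed.

Lemma mem_all_lifts cs s x :
  x \in s -> {subset angle_lifts x.2 <= all_lifts cs s}.
Proof.
elim: s cs => [|y s ih] cs //; rewrite inE => /predU1P[->|xs] c cx.
  by apply: (sub_all_lifts (angle_lifts y.2 ++ cs)); rewrite mem_cat cx.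
exact: ih.
Qed.

Lemma hclose_sym Rad x y : hclose Rad x y = hclose Rad y x.
Proof.
rewrite /hclose /cosh_hdist -(cosN (x.2 - y.2)) opprB.
by rewrite (mulrC (cosh x.1)) (mulrC (sinh x.1)).
Qed.

(** Here [y] is the earlier point and [x] the later one. Only [x] has been tested against the other
    angle, so [cs'] stays arbitrary. *)
Definition separating Rad C d : Prop := forall cs cs' x y,
  good Rad C d cs' y -> good Rad C d cs x -> {subset angle_lifts y.2 <= cs} ->
  ~~ hclose Rad x y.

(** The good indices are independent, so a matching covers at most [2 * nbad] vertices. The extra 1
    accounts for the vertex that a near perfect matching may miss. *)
Lemma few_bad_no_npm Rad C d s : separating Rad C d ->
  ((nbad Rad C d [::] s).*2.+1 < size s)%N -> no_npm Rad s.
Proof.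
move=> sep; rewrite nbadE => few [M [Mm Mcov]].
pose G := finset (fun j : 'I_(size s) =>
  good Rad C d (all_lifts [::] (take j s)) (nth (0, 0) s j)).
have indep_lt : {in G &, forall i j : 'I_(size s), (i < j)%N ->
    hclose Rad (nth (0, 0) s j) (nth (0, 0) s i) = false}.
  move=> i j; rewrite !inE => Gi Gj ij; apply/negbTE/(sep _ _ _ _ Gi Gj).
  apply: mem_all_lifts; rewrite -(nth_take _ ij); apply: mem_nth.
  by rewrite size_take ltn_ord.
have indep : {in G &, forall i j : 'I_(size s), adj Rad i j = false}.
  move=> i j Gi Gj; rewrite /adj; have [//|ij /=] := eqVneq i j.
  move: ij; rewrite -val_eqE /= neq_ltn => /orP[] ij.
    by rewrite hclose_sym indep_lt.
  by rewrite indep_lt.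
have := card_cover_matching _ _ _ _ Mm indep.
have -> : (\sum_(i < size s) (i \notin G) = \sum_(j < size s)
    ~~ good Rad C d (all_lifts [::] (take j s)) (nth (0%R, 0%R) s j))%N.
  by apply: eq_bigr => i _; rewrite inE.
by rewrite mul2n; lia.
Qed.

(** * Separation in angle forces hyperbolic distance above [Rad] *)

Lemma cos_sep d t : 0 <= d -> d < `|t| -> d < `|t - 2 * pi| ->
  d < `|t + 2 * pi| -> `|t| <= 2 * pi -> cos t <= cos d.
Proof.
(* The cosine is even, which leaves [t] in [0, 2 pi]. It decreases on [0, pi], so [d] is compared
   with [t] up to [pi] and with [2 * pi - t] beyond. *)
move=> d0; wlog t0 : t / 0 <= t => [wlog_|].
  have [t0|t0] := leP 0 t; first exact: wlog_.
  rewrite -(cosN t) => h1 h2 h3 h4; apply: wlog_; rewrite ?normrN//.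
  - lra.
  - by rewrite -normrN opprD !opprK.
  - by rewrite -normrN opprD !opprK.
move=> + + _; rewrite (ger0_norm t0) => dt + t2.
rewrite ler0_norm ?opprB; last by lra.
move=> dt2; have [tpi|tpi] := leP t pi.
  by rewrite ltW// ltr_cos ?in_itv/=//; apply/andP; split; lra.
rewrite -(cosN t) -(cosD2pi (- t)) ltW// ltr_cos ?in_itv/=; last 2 first.
- by apply/andP; split; lra.
- by apply/andP; split; lra.
- by lra.
Qed.

Lemma sinh_ge0 t : 0 <= t -> 0 <= sinh t.
Proof. by move=> t0; rewrite /sinh divr_ge0// subr_ge0 ler_expR; lra. Qed.

Lemma ler_sinh : {homo (@sinh R) : u v / u <= v}.
Proof.
by move=> u v uv; rewrite /sinh ler_pM2r// lerB// ler_expR//; lra.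
Qed.

(** The expression is cosh (u - v). *)
Lemma coshB_ge0 (u v : R) : 0 <= cosh u * cosh v - sinh u * sinh v.
Proof.
have := mulr_ge0 (expR_ge0 u) (expR_ge0 (- v)).
have := mulr_ge0 (expR_ge0 (- u)) (expR_ge0 v).
rewrite /cosh /sinh; lra.
Qed.

(** The law of cosines writes cosh of the distance as cosh (rx - ry) + sinh rx sinh ry (1 - cos (tx
    - ty)). The first term is nonnegative, and in the layer the second is at least the right-hand
    side of the hypothesis. *)
Lemma separatingP Rad C d : 0 <= d -> C <= Rad ->
  cosh Rad < sinh (Rad - C) ^+ 2 * (1 - cos d) -> separating Rad C d.
Proof.
move=> d0 CR big cs cs' [rx tx] [ry ty] /=.
rewrite /good /hclose /cosh_hdist -ltNge.
move=> /and3P[/andP[/andP[/andP[/= ry0 ryR] ty0] typi] yC _].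
move=> /and3P[/andP[/andP[/andP[/= rx0 rxR] tx0] txpi] xC /allP xcs] sub.
have cosxy : cos (tx - ty) <= cos d.
  apply: cos_sep => //.
  - by apply: xcs; apply: sub; rewrite !inE eqxx orbT.
  - have -> : tx - ty - 2 * pi = tx - (ty + 2 * pi) by ring.
    by apply: xcs; apply: sub; rewrite !inE eqxx !orbT.
  - have -> : tx - ty + 2 * pi = tx - (ty - 2 * pi) by ring.
    by apply: xcs; apply: sub; rewrite !inE eqxx.
  - by rewrite ler_norml; apply/andP; split; lra.
have s0 : 0 <= sinh (Rad - C) by apply: sinh_ge0; lra.
have sxy : sinh (Rad - C) ^+ 2 <= sinh rx * sinh ry.
  by rewrite expr2 ler_pM// ler_sinh.
have := coshB_ge0 rx ry.
have : sinh (Rad - C) ^+ 2 * (1 - cos d) <=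
       sinh rx * sinh ry * (1 - cos (tx - ty)).
  by rewrite ler_pM ?sqr_ge0 ?lerD2l ?lerN2// subr_ge0 cos_le1.
lra.
Qed.

End Goodness.

(* No measurability is required: the integral of a nonnegative function is the
   supremum over simple functions below it. This matters because no_npm is not
   known to be a measurable event. *)
Lemma le_integral_nonneg d (T : measurableType d) (R : realType)
    (m : {measure set T -> \bar R}) (f g : T -> \bar R) :
  (forall x, 0 <= f x)%E -> (forall x, f x <= g x)%E ->
  (\int[m]_x f x <= \int[m]_x g x)%E.
Proof.
move=> f0 fg; have g0 x : (0 <= g x)%E by apply: le_trans (fg x).
rewrite !ge0_integralTE//; apply: le_ereal_sup => _ [h /= hf <-].
by exists h => // x; apply: le_trans (fg x).
Qed.

(** * Law of a single point *)

Section OnePoint.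
Local Open Scope classical_set_scope.
Context {R : realType}.
Notation mu := (@lebesgue_measure R).
Implicit Types (d c : R) (cs : seq R).

Definition free_angles d cs : set R :=
  [set t | 0 < t <= 2 * pi /\ all (fun c => d < `|t - c|) cs].

Lemma free_angles_cons d c cs :
  free_angles d (c :: cs) = free_angles d cs `\` `[c - d, c + d].
Proof.
apply/seteqP; split => t; rewrite /free_angles/= in_itv/= -ler_distl [d < _]ltNge.
  by move=> [t2 /andP[/negP ? ?]].
by move=> [[t2 tcs] /negP tc]; split => //; apply/andP.
Qed.

Lemma measurable_free_angles d cs : measurable (free_angles d cs).
Proof.
elim: cs => [|c cs ih]; last by rewrite free_angles_cons; apply: measurableD.
have -> : free_angles d [::] = `]0, 2 * pi].
  by apply/seteqP; split => t; rewrite /free_angles/= in_itv/=; [case|].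
exact: measurable_itv.
Qed.

(** Union bound: each element of [cs] removes an interval of length at most [2 * d]. *)
Lemma free_angles_ge d cs : 0 <= d ->
  ((2 * pi - 2 * d * (size cs)%:R)%:E <= mu (free_angles d cs))%E.
Proof.
move=> d0; elim: cs => [|c cs ih].
  have -> : free_angles d [::] = `]0, 2 * pi].
    by apply/seteqP; split => t; rewrite /free_angles/= in_itv/=; [case|].
  rewrite lebesgue_measure_itv/= lte_fin mulr0 subr0 mulr_gt0 ?pi_gt0//.
  by rewrite -EFinD subr0.
rewrite free_angles_cons -(leeD2rE _ _ (x := (2 * d)%:E))//.
rewrite -EFinD.
have -> : 2 * pi - 2 * d * (size (c :: cs))%:R + 2 * d =
    2 * pi - 2 * d * (size cs)%:R by rewrite /= -natr1; ring.
apply: (le_trans ih).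
rewrite (measureDI mu (measurable_free_angles d cs)
  (measurable_itv (Interval (BLeft (c - d)) (BRight (c + d))))).
apply: leeD => //; apply: (@le_trans _ _ (mu `[c - d, c + d])).
  apply: le_measure; rewrite ?inE//.
  by apply: measurableI => //; exact: measurable_free_angles.
rewrite lebesgue_measure_itv/=; case: ifP => _; last by rewrite lee_fin mulr_ge0.
by rewrite -EFinB lee_fin; lra.
Qed.

Lemma cosh_gt1 (x : R) : 0 < x -> 1 < cosh x.
Proof.
move=> x0; have e1 : 1 < expR x by rewrite expR_gt1.
have e2 : expR (- x) < 1 by rewrite expR_lt1; lra.
have := expRxMexpNx_1 x; rewrite /cosh; nra.
Qed.

Lemma is_derive_cosh (x : R) : is_derive x 1 (@cosh R) (sinh x).
Proof.
rewrite /cosh /sinh.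
apply: is_derive_eq.
by rewrite /= /GRing.scale /=; field.
Qed.

End OnePoint.

(** * Radial law and the mass of the boundary layer *)

Section Layer.
Local Open Scope classical_set_scope.
Context {R : realType} (alpha Rad : R).
Hypotheses (alpha0 : 0 < alpha) (Rad0 : 0 < Rad).
Notation mu := (@lebesgue_measure R).

Definition radial_dens (r : R) : R :=
  alpha * sinh (alpha * r) / (cosh (alpha * Rad) - 1).

(** For 0 <= a < Rad, the probability that a random point has radius at least [a]. *)
Definition radial_tail (a : R) : R :=
  (cosh (alpha * Rad) - cosh (alpha * a)) / (cosh (alpha * Rad) - 1).

(** The bound does not depend on [Rad], so [C] can be fixed before [n]. With x = alpha Rad and y =
    alpha C it reduces to exp(-x) (exp y - exp(-y)) / 2 <= 1 - exp(-y), which follows from exp(-x)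
    <= exp(-y) <= 1. *)
Lemma radial_tail_ge C : 0 <= C <= Rad ->
  1 - expR (- (alpha * C)) <= radial_tail (Rad - C).
Proof.
move=> /andP[C0 CR]; have n0 : 0 < cosh (alpha * Rad) - 1.
  by rewrite subr_gt0 cosh_gt1// mulr_gt0.
rewrite /radial_tail ler_pdivlMr// (mulrBr alpha).
set x := alpha * Rad in n0 *; set y := alpha * C.
have y0 : 0 <= y by rewrite mulr_ge0// ltW.
have yx : expR (- x) <= expR (- y) by rewrite ler_expR lerN2 ler_pM2l.
have Y1 : expR (- y) <= 1 by rewrite -expR0 ler_expR; lra.
have x'0 := expR_gt0 (- x); have Y0 := expR_gt0 y.
have xx := expRxMexpNx_1 x; have yy := expRxMexpNx_1 y.
rewrite /cosh opprB.
have -> : expR (x - y) = expR x * expR (- y) by rewrite expRD.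
have -> : expR (y - x) = expR y * expR (- x) by rewrite expRD.
have h : expR (- x) * (expR y - expR (- y)) <= expR (- y) * (expR y - expR (- y)).
  by rewrite ler_wpM2r// subr_ge0; nra.
nra.
Qed.

Lemma radial_norm_gt0 : 0 < cosh (alpha * Rad) - 1.
Proof. by rewrite subr_gt0 cosh_gt1// mulr_gt0. Qed.

Lemma radial_dens_ge0 r : 0 <= r -> 0 <= radial_dens r.
Proof.
move=> r0; rewrite /radial_dens divr_ge0 ?(ltW radial_norm_gt0)//.
by rewrite mulr_ge0 ?sinh_ge0 ?mulr_ge0// ltW.
Qed.

(** An antiderivative of [radial_dens]; it differs from the distribution function by a constant,
    which cancels in differences. *)
Definition radial_cdf (r : R) : R := cosh (alpha * r) / (cosh (alpha * Rad) - 1).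

Lemma is_derive_radial_cdf (r : R) : is_derive r 1 radial_cdf (radial_dens r).
Proof.
have h : is_derive r 1 (fun r => alpha * r) alpha.
  by apply: is_derive_eq; rewrite /GRing.scale/=; ring.
have := is_derive1_comp (is_derive_cosh (alpha * r)) h => h2.
rewrite /radial_cdf /radial_dens; apply: is_derive_eq.
by rewrite /GRing.scale /=; ring.
Qed.

Lemma continuous_radial_dens : continuous radial_dens.
Proof.
move=> r; rewrite /radial_dens /sinh.
apply: (@cvgM R R^o); last exact: cvg_cst.
apply: cvgM; first exact: cvg_cst.
apply: cvgM; last exact: cvg_cst.
apply: cvgB.
  apply: continuous_comp; last exact: continuous_expR.
  by apply: cvgM; [exact: cvg_cst|exact: cvg_id].
apply: continuous_comp; last exact: continuous_expR.
by apply: cvgN; apply: cvgM; [exact: cvg_cst|exact: cvg_id].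
Qed.

Lemma measurable_radial_dens (D : set R) : measurable D ->
  measurable_fun D (fun r => (radial_dens r)%:E).
Proof.
move=> mD; apply/measurable_EFinP; apply: measurable_funTS.
exact: continuous_measurable_fun continuous_radial_dens.
Qed.

Lemma integral_radial_dens a : a < Rad ->
  (\int[mu]_(r in `[a, Rad[) (radial_dens r)%:E = (radial_tail a)%:E)%E.
Proof.
move=> aR; rewrite integral_itv_bndo_bndc; last exact: measurable_radial_dens.
have cF r : {for r, continuous radial_cdf}.
  apply: differentiable_continuous; apply/derivable1_diffP.
  by have := is_derive_radial_cdf r => -[].
rewrite (@continuous_FTC2 _ _ radial_cdf)//.
- by rewrite -EFinB /radial_cdf /radial_tail mulrBl.
- exact/continuous_subspaceT/continuous_radial_dens.
- split.
  + by move=> r _; have := is_derive_radial_cdf r => -[].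
  + by apply: cvg_at_right_filter; exact: cF.
  + by apply: cvg_at_left_filter; exact: cF.
- move=> r _; rewrite derive1E.
  by have := is_derive_radial_cdf r => -[].
Qed.

Lemma dens_ge0 (x : Defs.point R) : 0 <= dens alpha Rad x.
Proof.
rewrite /dens; case: ifP => // /andP[/andP[/andP[r0 _] _] _].
have a0 := ltW alpha0.
apply: divr_ge0; first by rewrite mulr_ge0// sinh_ge0// mulr_ge0.
by rewrite !mulr_ge0 ?pi_ge0 ?ltW// radial_norm_gt0.
Qed.

Lemma densE r t : 0 <= r < Rad -> 0 < t <= 2 * pi ->
  dens alpha Rad (r, t) = radial_dens r / (2 * pi).
Proof.
move=> /andP[r0 rR] /andP[t0 tpi]; rewrite /dens /in_disk/= r0 rR t0 tpi/=.
by rewrite /radial_dens invfM; ring.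
Qed.

Lemma integral_indic2 (A B : set R) (a b : R) : measurable A -> measurable B ->
  0 <= a -> 0 <= b ->
  (\int[mu]_t (a * \1_A t + b * \1_B t)%:E = a%:E * mu A + b%:E * mu B)%E.
Proof.
move=> mA mB a0 b0; under eq_integral do rewrite EFinD !EFinM.
have mI (D : set R) : measurable D ->
    measurable_fun setT (fun t : R => (\1_D t : R)%:E).
  by move=> mD; apply/measurable_EFinP; exact: measurable_indic.
rewrite ge0_integralD//=; last 4 first.
- by move=> t _; rewrite mule_ge0 ?lee_fin.
- by apply: measurable_funeM; exact: mI.
- by move=> t _; rewrite mule_ge0 ?lee_fin.
- by apply: measurable_funeM; exact: mI.
rewrite !ge0_integralZl_EFin//=; [|exact: mI|exact: mI].
by rewrite !integral_indic// !setIT.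
Qed.

(** Radius and angle are independent, so a point is good with probability at least the product of
    the angular and radial factors. Since [h] need not be measurable, it is compared with explicit
    measurable functions, first in the angle and then in the radius. *)
Lemma integral_dens_ge (C d u v : R) cs (h : Defs.point R -> \bar R) :
  0 <= C <= Rad -> 0 <= d -> d * (size cs)%:R <= pi -> 0 <= u -> 0 <= v ->
  (forall x, 0 <= h x)%E ->
  (forall x, in_disk Rad x -> (u + v * (good Rad C d cs x)%:R)%:E <= h x)%E ->
  ((u + v * ((1 - d * (size cs)%:R / pi) * radial_tail (Rad - C)))%:E <=
    \int[mu]_r \int[mu]_t ((dens alpha Rad (r, t))%:E * h (r, t)))%E.
Proof.
move=> /andP[C0 CR] d0 dpi u0 v0 h0 hlb.
have pi0 := pi_gt0 R.
set pa := 1 - _; have pa0 : 0 <= pa by rewrite subr_ge0 ler_pdivrMr ?mul1r.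
pose dn (r : R) := (radial_dens r)%:E.
pose A0 : set R := `[0, Rad[; pose A1 : set R := `[Rad - C, Rad[.
have dn0 r : A0 r -> (0 <= dn r)%E.
  by rewrite /A0/= in_itv/= => /andP[r0 _]; rewrite lee_fin radial_dens_ge0.
have A10 : A1 `<=` A0.
  move=> r; rewrite /A0 /A1/= !in_itv/= => /andP[rC ->]; rewrite andbT; lra.
have patch0 A : A `<=` A0 -> forall r, (0 <= (dn \_ A) r)%E.
  by move=> AA0 r; rewrite patchE; case: ifPn => //; rewrite inE => /AA0; exact: dn0.
have mpatch A : measurable A -> measurable_fun setT (dn \_ A).
  move=> mA; apply/(measurable_restrictT _ _).1 => //.
  exact: measurable_radial_dens.
have mA0 : measurable A0 by exact: measurable_itv.
have mA1 : measurable A1 by exact: measurable_itv.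
have intZ A k : measurable A -> A `<=` A0 -> 0 <= k ->
    (\int[mu]_r (k%:E * (dn \_ A) r) = k%:E * \int[mu]_(r in A) dn r)%E.
  move=> mA AA0 k0; rewrite ge0_integralZl_EFin//= -?integral_mkcond//.
    by move=> r _; exact: patch0.
  exact: mpatch.
have tail0 : radial_tail 0 = 1.
  rewrite /radial_tail mulr0 {2}/cosh oppr0 expR0.
  rewrite (_ : (1 + 1) / 2 = 1); last by field.
  by rewrite divff// gt_eqF//; exact: radial_norm_gt0.
have tail_ge0 : 0 <= radial_tail (Rad - C).
  apply: le_trans (radial_tail_ge C _); last by rewrite C0.
  by rewrite subr_ge0 -expR0 ler_expR oppr_le0 mulr_ge0// ltW.
apply: (@le_trans _ _ (\int[mu]_r (u%:E * (dn \_ A0) r +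
                                   (v * pa)%:E * (dn \_ A1) r))%E).
  rewrite ge0_integralD//=; last 4 first.
  - by move=> r _; rewrite mule_ge0 ?lee_fin// patch0.
  - by apply: measurable_funeM; exact: mpatch.
  - by move=> r _; rewrite mule_ge0 ?lee_fin ?mulr_ge0// patch0.
  - by apply: measurable_funeM; exact: mpatch.
  rewrite !intZ ?mulr_ge0// integral_radial_dens// tail0 mule1.
  (* [integral_radial_dens] needs a left end strictly below [Rad]. For [C = 0] the tail vanishes and
     the layer term is dropped. *)
  have [C00|Cpos] := eqVneq C 0.
    rewrite C00 subr0 /radial_tail subrr mul0r !mulr0 addr0.
    rewrite leeDl// mule_ge0 ?lee_fin ?mulr_ge0// integral_ge0// => r /A10.
    exact: dn0.
  rewrite integral_radial_dens//; last first.
    by rewrite ltrBlDr ltrDl lt_neqAle eq_sym Cpos.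
  by rewrite -EFinM -EFinD mulrA.
apply: le_integral_nonneg => r.
  by rewrite adde_ge0 ?mule_ge0 ?lee_fin ?mulr_ge0 ?patch0.
have hd0 t : (0 <= (dens alpha Rad (r, t))%:E * h (r, t))%E.
  by rewrite mule_ge0 ?lee_fin ?dens_ge0.
rewrite !patchE; case: (boolP (r \in A0)) => [|rA0]; last first.
  have -> : (r \in A1) = false.
    by apply/negbTE; apply: contra rA0; rewrite !inE; exact: A10.
  by rewrite !mule0 adde0 integral_ge0.
rewrite inE => rA0.
pose K := radial_dens r / (2 * pi).
have := rA0; rewrite /A0/= in_itv/= => rR; have [r0 _] := andP rR.
have K0 : 0 <= K.
  by apply: divr_ge0; [exact: radial_dens_ge0|rewrite mulr_ge0// ltW].
pose w := v * (r \in A1)%:R.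
have w0 : 0 <= w by rewrite mulr_ge0.
have Ku0 : 0 <= K * u := mulr_ge0 K0 u0.
have Kw0 : 0 <= K * w := mulr_ge0 K0 w0.
have mF := measurable_free_angles d cs.
pose I0 : set R := `]0, 2 * pi].
(* At fixed radius the angular density is the constant [K]: every angle contributes [u], and the
   free angles contribute [v] more when the radius lies in the layer. *)
apply: (@le_trans _ _ (\int[mu]_t
  (K * u * \1_I0 t + K * w * \1_(free_angles d cs) t)%:E)%E); last first.
  apply: le_integral_nonneg => t.
    by rewrite lee_fin addr_ge0 ?(mulr_ge0 Ku0) ?(mulr_ge0 Kw0).
  rewrite !indicE; have [tI|tI] := boolP (t \in I0); last first.
    have -> : (t \in free_angles d cs) = false.
      apply/negbTE; apply: contra tI; rewrite !inE => -[t2 _].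
      by rewrite /I0/= in_itv.
    by rewrite !mulr0 addr0.
  have t2 : 0 < t <= 2 * pi by move: tI; rewrite inE /I0/= in_itv.
  rewrite densE// -/K mulr1 -mulrA -mulrDr EFinM lee_wpmul2l ?lee_fin//.
  have rtD : in_disk Rad (r, t) by rewrite /in_disk/= rR.
  apply: le_trans (hlb _ rtD); rewrite lee_fin lerD2l /w -mulrA ler_wpM2l//.
  rewrite -natrM mulnb ler_nat /good rtD/=.
  case: (boolP (r \in A1)) => //=; rewrite inE /A1/= in_itv/= => /andP[-> _].
  by case: (boolP (t \in _)) => //; rewrite inE => -[_ ->].
rewrite integral_indic2//; last exact: measurable_itv.
have := free_angles_ge d cs d0.
have -> : mu I0 = (2 * pi)%:E.
  by rewrite /I0 lebesgue_measure_itv/= lte_fin mulr_gt0// sube0.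
move=> /(lee_wpmul2l (_ : (0 <= (K * w)%:E)%E)) hF.
apply: (@le_trans _ _ ((K * u)%:E * (2 * pi)%:E +
  (K * w)%:E * (2 * pi - 2 * d * (size cs)%:R)%:E)%E); last first.
  by rewrite leeD2l// hF ?lee_fin.
have -> : (if r \in A1 then dn r else 0%E) = (radial_dens r * (r \in A1)%:R)%:E.
  by case: ifP; rewrite ?mulr1 ?mulr0.
rewrite /dn -!EFinM -!EFinD lee_fin /K /w /pa.
rewrite le_eqVlt; apply/orP; left; apply/eqP.
by move: (lt0r_neq0 pi0); generalize (@pi R) => P P0; field.
Qed.

(** * Iterated integrals over independent points and the count of bad points *)

Lemma iid_int_ge0 k (g : seq (Defs.point R) -> \bar R) :
  (forall s, 0 <= g s)%E -> (0 <= iid_int alpha Rad k g)%E.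
Proof.
elim: k g => [|k ih] g g0 /=; first exact: g0.
apply: integral_ge0 => r _; apply: integral_ge0 => t _.
by rewrite mule_ge0 ?lee_fin ?dens_ge0// ih.
Qed.

Lemma le_iid_int k (f g : seq (Defs.point R) -> \bar R) :
  (forall s, 0 <= f s)%E -> (forall s, size s = k -> f s <= g s)%E ->
  (iid_int alpha Rad k f <= iid_int alpha Rad k g)%E.
Proof.
elim: k f g => [|k ih] f g f0 fg /=; first exact: fg.
apply: le_integral_nonneg => r.
  apply: integral_ge0 => t _.
  by rewrite mule_ge0 ?lee_fin ?dens_ge0// iid_int_ge0.
apply: le_integral_nonneg => t.
  by rewrite mule_ge0 ?lee_fin ?dens_ge0// iid_int_ge0.
rewrite lee_wpmul2l ?lee_fin ?dens_ge0// ih// => s sk.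
by rewrite fg//= sk.
Qed.

(* 3 / 2 = 5/6 * 1 + 1/6 * 4 bounds the conditional expectation of 4 ^ [bad].
   The truncation at 0 keeps integrands nonnegative, so that le_integral_nonneg
   applies. *)
Lemma iid_int_nbad_ge (C d : R) (m k : nat) (cs : seq R) (a : R) :
  0 <= C <= Rad -> 11 / 12 <= radial_tail (Rad - C) ->
  0 <= d -> d * m%:R <= pi / 12 -> 0 <= a -> (size cs + 3 * k <= m)%N ->
  ((Num.max 0 (1 - a * (3 / 2) ^+ k))%:E <=
    iid_int alpha Rad k (fun s =>
      (Num.max 0 (1 - a * 4 ^+ nbad Rad C d cs s))%:E))%E.
Proof.
move=> C0 tailC d0 dm; have pi0 := pi_gt0 R.
elim: k cs a => [|k ih] cs a a0 szm; first by rewrite /= !expr0.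
pose a' := a * (3 / 2) ^+ k.
have a'0 : 0 <= a' by rewrite mulr_ge0// exprn_ge0.
(* [u] is the inductive bound when the first point is bad, and [u + v] the one when it is good. *)
pose u := Num.max 0 (1 - 4 * a').
pose v := Num.max 0 (1 - a') - u.
have u0 : 0 <= u by rewrite /u le_max lexx.
have v0 : 0 <= v.
  by rewrite subr_ge0 /u ge_max !le_max lexx/= lerD2l lerN2; apply/orP; right; lra.
have dcs : d * (size cs)%:R <= pi / 12.
  apply: le_trans dm; rewrite ler_wpM2l// ler_nat.
  by apply: leq_trans szm; rewrite leq_addr.
pose h x := iid_int alpha Rad k (fun s =>
   (Num.max 0 (1 - a * 4 ^+ nbad Rad C d cs (x :: s)))%:E).
have h0 x : (0 <= h x)%E.
  by apply: iid_int_ge0 => s; rewrite lee_fin le_max lexx.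
have hge x : in_disk Rad x -> ((u + v * (good Rad C d cs x)%:R)%:E <= h x)%E.
  move=> _; pose b := a * 4 ^+ (~~ good Rad C d cs x).
  have b0 : 0 <= b by rewrite mulr_ge0// exprn_ge0.
  (* Each revealed point adds three lifts, so passing from [k.+1] to [k] keeps the total within
     [m]. *)
  have szx : (size (angle_lifts x.2 ++ cs) + 3 * k <= m)%N.
    by rewrite size_cat/=; lia.
  apply: (@le_trans _ _ (Num.max 0 (1 - b * (3 / 2) ^+ k))%:E).
    rewrite lee_fin /u /v /b /a'; case: (good _ _ _ _ _) => /=.
      by rewrite expr0 !mulr1 addrC subrK.
    by rewrite expr1 mulr0 addr0 (mulrC 4) mulrAC.
  apply: (le_trans (ih _ _ b0 szx)); apply: le_iid_int => s.
    by rewrite lee_fin le_max lexx.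
  by move=> _; rewrite lee_fin /= exprD mulrA.
have dpi : d * (size cs)%:R <= pi by apply: le_trans dcs _; lra.
apply: le_trans (integral_dens_ge C d u v cs h C0 d0 dpi u0 v0 h0 hge).
rewrite lee_fin.
set q := _ * radial_tail _.
(* Angular and radial factors are each at least 11/12, and 121/144 > 5/6. *)
have q56 : 5 / 6 <= q.
  have h1 : 11 / 12 <= 1 - d * (size cs)%:R / pi.
    by rewrite lerBrDr -lerBrDl ler_pdivrMr//; lra.
  apply: (@le_trans _ _ ((11 / 12) * (11 / 12))); first by lra.
  by rewrite ler_pM.
(* This is the average of the bad and good bounds with weights 1/6 and 5/6; dropping the truncations
   gives (1 - 4 a') / 6 + 5 (1 - a') / 6 = 1 - 3 a' / 2. *)
apply: (@le_trans _ _ (u + v * (5 / 6))); last by rewrite lerD2l ler_wpM2l.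
rewrite exprS mulrCA -/a'.
have := le_max 0 0 (1 - 4 * a'); have := le_max (1 - 4 * a') 0 (1 - 4 * a').
have := le_max (1 - a') 0 (1 - a').
rewrite !lexx !orbT -/u ge_max => v1 u1 _.
by apply/andP; split; rewrite /v in v0 *; lra.
Qed.

End Layer.

(** * Poisson mixture *)

Section Poisson.
Local Open Scope classical_set_scope.
Context {R : realType}.

(** Averaging x^k over a Poisson(n) number k gives exp(n (x - 1)). The lower bounds may be negative,
    so partial sums are compared before passing to the limit. *)
Lemma poisson_prob_ge (n : nat) (alpha Rad c x d y : R)
    (P : seq (Defs.point R) -> Prop) :
  (forall k, (0 <= iid_prob alpha Rad k P)%E) ->
  (forall k, (1 - c * x ^+ k - d * y ^+ k)%:E <= iid_prob alpha Rad k P)%E ->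
  ((1 - c * expR (n%:R * (x - 1)) - d * expR (n%:R * (y - 1)))%:E <=
    Defs.poisson_prob n alpha Rad P)%E.
Proof.
move=> P0 Pge.
pose N : R := n%:R.
pose u k := expR (- N) * N ^+ k / k`!%:R.
have u0 k : 0 <= u k by rewrite !mulr_ge0 ?expR_ge0 ?exprn_ge0 ?invr_ge0.
pose w k := expR (- N) *
  (exp_coeff N k - c * exp_coeff (N * x) k - d * exp_coeff (N * y) k).
have wE k : w k = u k * (1 - c * x ^+ k - d * y ^+ k).
  by rewrite /w /u /exp_coeff /= !exprMn; ring.
have wcvg : series w @ \oo --> 1 - c * expR (N * (x - 1)) - d * expR (N * (y - 1)).
  have -> : 1 - c * expR (N * (x - 1)) - d * expR (N * (y - 1)) =
      expR (- N) * (expR N - c * expR (N * x) - d * expR (N * y)).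
    rewrite !mulrBr mulr1 !expRD; have := expRxMexpNx_1 N.
    by move=> e; rewrite -[X in X - _ - _ = _]e; ring.
  have -> : series w = (fun k => expR (- N) * (series (exp_coeff N) k
      - c * series (exp_coeff (N * x)) k - d * series (exp_coeff (N * y)) k)).
    apply/funext => k; rewrite /series/= !mulr_sumr -!sumrB mulr_sumr.
    exact: eq_bigr.
  apply: cvgM; first exact: cvg_cst.
  apply: cvgB; [apply: cvgB|]; [|apply: cvgM; first exact: cvg_cst..];
    exact: is_cvg_series_exp_coeff.
rewrite /Defs.poisson_prob.
have Ecvg : (EFin \o series w) k @[k --> \oo] -->
    (1 - c * expR (N * (x - 1)) - d * expR (N * (y - 1)))%:E.
  by apply: cvg_EFin; [exact: nearW|exact: wcvg].
rewrite -(cvg_lim _ Ecvg)//.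
apply: lee_lim.
- by apply/cvg_ex; eexists; exact: Ecvg.
- apply: is_cvg_nneseries => k _ _.
  by rewrite mule_ge0 ?lee_fin ?u0.
- apply: nearW => k; rewrite /series /= -sumEFin; apply: lee_sum => i _.
  by rewrite wE EFinM lee_wpmul2l ?lee_fin ?u0.
Qed.

(* The last subtracted term makes the bound trivial for k > 3 n, so that it can
   be summed over all k. *)
Lemma iid_prob_no_npm_ge (alpha Rad C d : R) (n k : nat) :
  0 < alpha -> 0 < Rad -> 0 <= C <= Rad ->
  11 / 12 <= radial_tail alpha Rad (Rad - C) ->
  0 <= d -> d * (9 * n)%:R <= pi / 12 -> separating Rad C d ->
  ((1 - 2 * (3 / 4) ^+ k - (8 ^+ n)^-1 * 2 ^+ k)%:E <=
    iid_prob alpha Rad k (@no_npm R Rad))%E.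
Proof.
move=> a0 R0 CR tail d0 dn sep.
have p0 : 0 <= 2 * (3 / 4 : R) ^+ k by rewrite mulr_ge0// exprn_ge0.
have [kn|nk] := leqP k (3 * n); last first.
  apply: (@le_trans _ _ 0%E); last first.
    by apply: iid_int_ge0 => // s; rewrite lee_fin.
  have : 1 <= (8 ^+ n)^-1 * 2 ^+ k :> R.
    rewrite mulrC ler_pdivlMr ?exprn_gt0// mul1r.
    have -> : 8 ^+ n = 2 ^+ (3 * n) :> R by rewrite exprM; congr (_ ^+ _); ring.
    by rewrite ler_weXn2l ?ler1n// ltnW.
  by rewrite lee_fin; lra.
have q0 : 0 <= (8 ^+ n)^-1 * 2 ^+ k :> R.
  by rewrite mulr_ge0 ?invr_ge0 ?exprn_ge0.
(* With this choice [a * 4 ^+ b] is 2^(2b + 1 - k), which is at least 1 exactly when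
   [few_bad_no_npm] does not apply. Hence the truncated expression is at most the indicator of
   [no_npm]: Markov's inequality in pointwise form. *)
pose a : R := 2 / 2 ^+ k.
have a_ge0 : 0 <= a by rewrite divr_ge0// exprn_ge0.
have sz : (size (@nil R) + 3 * k <= 9 * n)%N by rewrite add0n; lia.
have := iid_int_nbad_ge alpha Rad a0 R0 C d _ _ _ _ CR tail d0 dn a_ge0 sz.
move=> lb; apply: (@le_trans _ _ (Num.max 0 (1 - a * (3 / 2) ^+ k))%:E).
  rewrite lee_fin le_max; apply/orP; right.
  have -> : a * (3 / 2) ^+ k = 2 * (3 / 4) ^+ k.
    rewrite /a -mulrA; congr (_ * _); rewrite mulrC -expr_div_n.
    by congr (_ ^+ _); field.
  by lra.
apply: (le_trans lb); apply: le_iid_int => //.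
  by move=> s; rewrite lee_fin le_max lexx.
move=> s sk.
have a4 b : a * 4 ^+ b = 2 ^+ (b.*2.+1) / 2 ^+ k.
  rewrite /a mulrAC; congr (_ / _); rewrite exprS -mul2n exprM.
  by congr (_ * _ ^+ _); ring.
rewrite lee_fin a4 indicE; have [few|many] := ltnP (nbad Rad C d [::] s).*2.+1 k.
  have -> : s \in (no_npm (R:=R) Rad : set _).
    by rewrite inE; apply: (few_bad_no_npm Rad C d) => //; rewrite sk.
  by rewrite ge_max ler01 gerBl divr_ge0// exprn_ge0.
rewrite ge_max ler0n/=; apply: (@le_trans _ _ 0); last by rewrite ler0n.
rewrite subr_le0 ler_pdivlMr ?exprn_gt0// mul1r.
by rewrite ler_weXn2l// ler1n.
Qed.

End Poisson.

(** * Angular range of adjacency in the boundary layer *)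

Section AngularRange.
Context {R : realType}.

Lemma sin_le_id (x : R) : 0 <= x -> sin x <= x.
Proof.
rewrite le_eqVlt => /predU1P[<-|x0]; first by rewrite sin0.
have [|c _] := @MVT R sin cos 0 x x0 (fun y _ => is_derive_sin y).
  exact/continuous_subspaceT/continuous_sin.
by rewrite sin0 !subr0 => ->; rewrite ler_piMl ?cos_le1// ltW.
Qed.

Lemma cos_half (x : R) : cos x = 1 - 2 * sin (x / 2) ^+ 2.
Proof.
rewrite [in LHS](_ : x = (x / 2) *+ 2); last by rewrite mulr2n; field.
by rewrite cos_mulr2n cos2sin2 mulr2n; ring.
Qed.

(** By the mean value theorem sin x = x cos c with 0 < c < 1, and cos c >= 1 - c^2 / 2 >= 1/2. *)
Lemma sin_ge_half (x : R) : 0 <= x <= 1 -> x / 2 <= sin x.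
Proof.
rewrite le_eqVlt => /andP[/predU1P[<-|x0] x1]; first by rewrite sin0 mul0r.
have [|c] := @MVT R sin cos 0 x x0 (fun y _ => is_derive_sin y).
  exact/continuous_subspaceT/continuous_sin.
rewrite in_itv/= => /andP[c0 cx]; rewrite sin0 !subr0 => ->.
have sc : sin (c / 2) <= c / 2 by apply: sin_le_id; lra.
have sc0 : 0 <= sin (c / 2).
  by apply/ltW/sin2_gt0; apply/andP; split; lra.
by rewrite cos_half; nra.
Qed.

Lemma one_minus_cos_ge (x : R) : 0 <= x <= 1 -> x ^+ 2 / 8 <= 1 - cos x.
Proof.
move=> /andP[x0 x1]; have := @sin_ge_half (x / 2).
have -> : 0 <= x / 2 <= 1 by apply/andP; split; lra.
by move=> /(_ isT); rewrite cos_half; nra.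
Qed.

Lemma cosh_le_expR (x : R) : 0 <= x -> cosh x <= expR x.
Proof.
move=> x0; have : expR (- x) <= expR x by rewrite ler_expR; lra.
by rewrite /cosh; lra.
Qed.

Lemma sinh_ge_expR (x : R) : 1 <= x -> expR x / 4 <= sinh x.
Proof.
move=> x1; have := expR_ge1Dx x.
have : expR (- x) <= 1 by rewrite -expR0 ler_expR; lra.
by rewrite /sinh; lra.
Qed.

Lemma expR1_le4 : expR 1 <= 4 :> R.
Proof.
have := expR_ge1Dx (- (1 / 2) : R); have := expR_gt0 (1 / 2 : R).
have := expRxMexpNx_1 (1 / 2 : R).
have -> : expR 1 = expR (1 / 2) ^+ 2 :> R.
  by rewrite -expRM_natl; congr expR; field.
set e := expR (1 / 2) => ee e0 e'.
have : e <= 2 by nra.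
nra.
Qed.

(** The factor 16 makes (exp(Rad - C) / 4)^2 d^2 / 8 equal to 2 exp Rad, which strictly exceeds cosh
    Rad. *)
Lemma separating_layer (Rad C : R) (d := 16 * expR C / expR (Rad / 2)) :
  0 <= C -> 1 <= Rad - C -> d <= 1 -> separating Rad C d.
Proof.
move=> C0 RC d1.
have e0 := expR_gt0 (Rad / 2).
have d0 : 0 <= d by rewrite divr_ge0 ?mulr_ge0 ?expR_ge0.
apply: separatingP => //; first by rewrite -subr_ge0; exact: le_trans RC.
apply: (@le_lt_trans _ _ (expR Rad)); first by apply: cosh_le_expR; lra.
apply: (@lt_le_trans _ _ ((expR (Rad - C) / 4) ^+ 2 * (d ^+ 2 / 8))); last first.
  have s4 := sinh_ge_expR _ RC.
  have s0 : 0 <= expR (Rad - C) / 4 by rewrite divr_ge0 ?expR_ge0.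
  apply: ler_pM; rewrite ?divr_ge0 ?sqr_ge0//.
    by rewrite lerXn2r ?nnegrE// (le_trans s0).
  by apply: one_minus_cos_ge; rewrite d0.
have c0 := expR_gt0 C.
have E : expR Rad = expR (Rad / 2) ^+ 2.
  by rewrite -expRM_natl; congr expR; field.
rewrite expRD expRN E /d.
have -> : (expR (Rad / 2) ^+ 2 / expR C / 4) ^+ 2 *
    ((16 * expR C / expR (Rad / 2)) ^+ 2 / 8) = 2 * expR (Rad / 2) ^+ 2.
  by field; rewrite !gt_eqF.
by rewrite ltr_pMl ?exprn_gt0// ltr1n.
Qed.

End AngularRange.

(** * Choice of constants and decay of the failure probability *)

Theorem mainTheorem3 (R : realType) (alpha : R) :
  0 < alpha -> alpha < 1 / 2 ->
  exists nu0 : R, 0 < nu0 /\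
    forall nu : R, 0 < nu -> nu < nu0 ->
      forall eps : R, 0 < eps ->
        exists N : nat, forall n : nat, (N <= n)%N -> nu < n%:R ->
          ((1 - eps / Num.sqrt (n%:R))%:E
             <= GPo_prob n alpha nu (@no_npm R))%E.
Proof.
move=> alpha0 _.
(* Then the layer misses mass at most exp(-12) <= 1/13 < 1/12. *)
pose C := 12 / alpha.
have C0 : 0 <= C by rewrite divr_ge0// ltW.
have eC0 := expR_gt0 C.
have K0 : 0 < 30 * 30 * expR C by rewrite !mulr_gt0.
(* Since d n = 16 exp(C) nu, this gives 9 d n < 144/900 < 1/6 <= pi/12. The factor 9 is three lifts
   for each of at most 3n points. *)
exists (1 / (30 * 30 * expR C)); split; first by rewrite divr_gt0.
move=> nu nu_gt0; rewrite ltr_pdivlMr // => nu_small eps eps0.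
have nu1 : nu < 1.
  have := expR_ge1Dx C; nra.
(* The second threshold ensures C + 1 <= Rad / 2, and the third makes the final error smaller than
   eps / sqrt n. *)
exists (maxn 1 (maxn (Num.trunc (expR (C + 1))).+1
                     (Num.trunc (3 * 8 ^+ 2 / eps)).+1)) => n.
rewrite !geq_max => /and3P[n1 nC neps] _.
pose N : R := n%:R.
have N1 : 1 <= N by rewrite ler1n.
have NC : expR (C + 1) < N.
  by apply: (lt_le_trans (truncnS_gt _)); rewrite ler_nat.
have Neps : 3 * 8 ^+ 2 < N * eps.
  rewrite -ltr_pdivrMr//.
  by apply: (lt_le_trans (truncnS_gt _)); rewrite ler_nat.
have nnu : 0 < N / nu by rewrite divr_gt0// (lt_le_trans _ N1).
rewrite /GPo_prob; set Rad := diskR n nu.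
have Rad2 : expR (Rad / 2) = N / nu.
  have -> : Rad / 2 = ln (N / nu) by rewrite /Rad /diskR -/N; field.
  by rewrite lnK.
have RadC : C + 1 <= Rad / 2.
  rewrite -ler_expR Rad2 ler_pdivlMr//; have := expR_ge0 (C + 1); nra.
have Rad0 : 0 < Rad by lra.
pose d := 16 * expR C / expR (Rad / 2).
have dE : d * N = 16 * (expR C * nu).
  by rewrite /d Rad2; field; rewrite !gt_eqF//; lra.
have d0 : 0 <= d by rewrite divr_ge0 ?mulr_ge0 ?expR_ge0.
have sep : separating Rad C d.
  by apply: separating_layer => //; rewrite -/d; [lra|nra].
have dn : d * (9 * n)%:R <= pi / 12.
  have := pi_ge2 R; rewrite natrM -/N; lra.
have CR : 0 <= C <= Rad by apply/andP; split; lra.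
have tail : 11 / 12 <= radial_tail alpha Rad (Rad - C).
  apply: le_trans (radial_tail_ge alpha Rad alpha0 Rad0 C CR).
  have -> : alpha * C = 12 by rewrite /C mulrC divfK ?gt_eqF.
  have := expR_ge1Dx (12 : R); have := expRxMexpNx_1 (12 : R).
  by have := expR_gt0 (12 : R); have := expR_gt0 (- 12 : R); nra.
apply: le_trans (poisson_prob_ge n alpha Rad 2 (3 / 4) (8 ^+ n)^-1 2 _ _
  (fun k => iid_prob_no_npm_ge alpha Rad C d n k alpha0 Rad0 CR tail d0 dn sep)).
  2: by move=> k; apply: iid_int_ge0 => // s; rewrite lee_fin.
pose e : R := expR (N / 4).
have e1 : expR (N * (3 / 4 - 1)) = e^-1.
  by rewrite /e -expRN; congr expR; field.
have N0 : 0 < N by lra.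
have e0 : 0 < e by exact: expR_gt0.
have eN : e = expR (1 / 4) ^+ n.
  by rewrite -expRM_natl; congr expR; rewrite -/N; field.
have quarter : expR (1 / 4) <= 2 :> R.
  have := expR_ge1Dx (- (1 / 4) : R); have := expRxMexpNx_1 (1 / 4 : R).
  by have := expR_gt0 (1 / 4 : R); nra.
(* The n-th power of exp(1) exp(1/4) / 8 <= 4 * 2 / 8 = 1. *)
have e2 : (8 ^+ n)^-1 * expR (N * (2 - 1)) <= e^-1.
  have -> : expR (N * (2 - 1)) = expR 1 ^+ n.
    by rewrite -expRM_natl; congr expR; rewrite -/N; ring.
  rewrite -[e^-1]mul1r ler_pdivlMr// mulrC mulrCA mulrC.
  rewrite ler_pdivrMr ?exprn_gt0// mul1r eN -exprMn.
  rewrite lerXn2r ?nnegrE ?mulr_ge0 ?expR_ge0//.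
  have := expR1_le4 (R := R); have := expR_gt0 (1 / 4 : R).
  by have := expR_gt0 (1 : R); nra.
(* A quadratic bound suffices here: exp(N/4) is the square of exp(N/8) >= N/8. *)
have e3 : 3 / e <= 3 * (8 / N) ^+ 2.
  rewrite ler_wpM2l//.
  have -> : (8 / N) ^+ 2 = ((N / 8) ^+ 2)^-1 by field; rewrite gt_eqF.
  rewrite lef_pV2 ?posrE ?exprn_gt0 ?divr_gt0//.
  have -> : e = expR (N / 8) ^+ 2 by rewrite -expRM_natl; congr expR; field.
  rewrite lerXn2r ?nnegrE ?expR_ge0 ?divr_ge0 ?ltW//.
  by have := expR_ge1Dx (N / 8); lra.
rewrite lee_fin -/N e1.
have e4 : 3 * (8 / N) ^+ 2 <= eps / Num.sqrt N.
  have s0 : 0 < Num.sqrt N by rewrite sqrtr_gt0.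
  have sN : Num.sqrt N <= N.
    rewrite -[leRHS]gtr0_norm// -sqrtr_sqr ler_sqrt ?sqr_ge0//; nra.
  rewrite ler_pdivlMr// expr_div_n mulrA mulrAC ler_pdivrMr ?exprn_gt0//.
  by rewrite expr2; nra.
lra.
Qed.
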